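(* Let $\Sigma$ be a horizontal decomposition of $R$, let $\Delta$ be a finite set of conditional domain constraints (CDCs) over $R$, and let $\Pi_{\text{aux}}$ be the auxiliary theory for $\Pi=\Pi_\Delta\cup\Pi_\Sigma$. Then $\Sigma$ is lossless under $\Delta$ if and only if the $\alpha$-filtering $\Pi^\alpha=\Pi_\Delta^\alpha\cup\Pi_\Sigma^\alpha$ of $\Pi$ is unsatisfiable for every valuation $\alpha$ of $\mathsf{var}_{\text p}(\Pi)$ satisfying $\Pi_{\text{aux}}$.
   Context: Setting. $\mathbf{dom}$ is a possibly infinite set of arbitrary values; $\mathbf{idom}$ is a set of values from a specific interpreted domain (e.g. $\mathbb Z$) on which predicates and functions are defined according to a first-order language $\mathfrak C$ closed under negation. $R$ is a relation symbol of arity $n$ whose first $k$ positions are non-interpreted (values from $\mathbf{dom}$) and whose remaining $n-k$ positions are interpreted (values from $\mathbf{idom}$). A tuple is an element of $\mathbf{dom}^k\times\mathbf{idom}^{n-k}$. Variables $\overline x=(x_1,\dots,x_k)$ refer to non-interpreted positions, $\overline y=(y_1,\dots,y_{n-k})$ to interpreted ones ($y_i$ refers to position $k+i$). $\mathfrak C$-formulae have free variables among $\overline y$; a set of $\mathfrak C$-formulae is satisfiable if some assignment $\beta:\{y_1,\dots,y_{n-k}\}\to\mathbf{idom}$ makes all of them true under the semantics of $\mathfrak C$. All instances (associating relation symbols with sets of tuples) are finite; entailment $\models$ is with respect to finite instances. CDCs. A CDC is a formula $\forall\overline x,\overline y.\,(R(\overline x,\overline y)\land\lambda(\overline x))\to\delta(\overline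 y)$, where $\lambda$ is a Boolean combination of equalities $x_i=a$ with $a\in\mathbf{dom}$ (possibly $\top$) and $\delta(\overline y)\in\mathfrak C$. Horizontal decomposition. $\Sigma$ is a finite set of view definitions, one for each view symbol $V_1,\dots,V_m$ (each of the same arity and position types as $R$), of the form $\forall\overline x,\overline y.\,V_i(\overline x,\overline y)\leftrightarrow(R(\overline x,\overline y)\land\lambda_i(\overline x)\land\sigma_i(\overline y))$, with $\lambda_i$ a Boolean combination of equalities as for CDCs (possibly $\top$) and $\sigma_i\in\mathfrak C$; the conjunct $\sigma_i$ may be absent. $\Sigma$ is lossless under $\Delta$ if $\Delta\cup\Sigma\models\forall\overline x,\overline y.\,R(\overline x,\overline y)\leftrightarrow\bigvee_{i}V_i(\overline x,\overline y)$. Propositional theories. For a condition $\lambda$, let $P_\lambda$ be the propositional formula obtained by replacing each equality $x_j=a$ by the propositional variable $p_j^a$. $\Pi_\Delta$ contains, for each CDC $\lambda\to\delta$ in $\Delta$, the formula $P_\lambda\to v$ with $v$ a fresh propositional variable and $\mathsf{idf}(v)=\delta(\overline y)$. $\Pi_\Sigma$ contains, for each view definition in $\Sigma$ with conditions $\lambda_i,\sigma_i$, the formula $P_{\lambda_i}\to v_i'$, where $v_i'$ is a fresh propositional variable with $\mathsf{idf}(v_i')=\sigma_i(\overline y)$ if $\sigma_i$ is present, and $v_i'=\bot$ if $\sigma_i$ is absent. $\mathsf{var}_{\text p}(\Pi)$ is the set of all variables $p_j^a$ occurring in antecedents of formulae of $\Pi=\Pi_\Delta\cup\Pi_\Sigma$.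 The auxiliary theory $\Pi_{\text{aux}}$ for $\Pi$ consists of the formulae in $\Pi_\Sigma$ whose right-hand side is $\bot$ and of the axioms of unique value $p_j^a\land p_j^b\to\bot$ for all $p_j^a,p_j^b\in\mathsf{var}_{\text p}(\Pi)$ with $a\neq b$. A valuation assigns true or false to each propositional variable. For a valuation $\alpha$ of $\mathsf{var}_{\text p}(\Pi)$: $\Pi_\Delta^\alpha=\{\mathsf{idf}(v)\mid(P\to v)\in\Pi_\Delta,\ \alpha(P)=\text{true}\}$ and $\Pi_\Sigma^\alpha=\{\neg\mathsf{idf}(v')\mid(P\to v')\in\Pi_\Sigma,\ \alpha(P)=\text{true},\ v'\neq\bot\}$.
   Formalization: Added: for each non-interpreted position j, some value of dom is compared with x_j in no condition of Δ or Σ (automatic if dom is infinite; without it the claim fails, e.g. dom={a,b} with views x=a and x=b). Equality on dom and idom is taken as decidable. *)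

(* Defs.v *)
From HB Require Import structures.
From mathcomp Require Import all_boot.

Set Implicit Arguments.
Unset Strict Implicit.
Unset Printing Implicit Defensive.

Record signature := Signature {
  fsym : Type;
  fsym_arity : fsym -> nat;
  psym : Type;
  psym_arity : psym -> nat
}.

(* Terms and formulae are well scoped: the free variables of an object of
   scope [m] are indexed by ['I_m]; a quantifier binds index [ord0]. *)
Inductive term (L : signature) (m : nat) : Type :=
| TVar of 'I_m
| TApp (f : fsym L) of ('I_(fsym_arity f) -> term L m).

Inductive formula (L : signature) (m : nat) : Type :=
| FTop
| FEq of term L m & term L m
| FPred (p : psym L) of ('I_(psym_arity p) -> term L m)
| FNot of formula L m
| FAnd of formula L m & formula L m
| FOr of formula L m & formula L m
| FAll of formula L m.+1
| FEx of formula L m.+1.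

Record structure (L : signature) (D : Type) := Structure {
  finterp : forall f : fsym L, ('I_(fsym_arity f) -> D) -> D;
  pinterp : forall p : psym L, ('I_(psym_arity p) -> D) -> Prop
}.

Definition env_cons (D : Type) (m : nat) (d : D) (b : 'I_m -> D) : 'I_m.+1 -> D :=
  fun i => if unlift ord0 i is Some j then b j else d.

Fixpoint teval L (D : Type) (M : structure L D) m (b : 'I_m -> D) (t : term L m) : D :=
  match t with
  | TVar i => b i
  | TApp f args => finterp M (fun i => teval M b (args i))
  end.

Fixpoint sat L (D : Type) (M : structure L D) m (b : 'I_m -> D) (phi : formula L m) : Prop :=
  match phi with
  | FTop => True
  | FEq t u => teval M b t = teval M b u
  | FPred p args => pinterp M (fun i => teval M b (args i))
  | FNot f => ~ sat M b f
  | FAnd f g => sat M b f /\ sat M b g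
  | FOr f g => sat M b f \/ sat M b g
  | FAll f => forall d, sat M (env_cons d b) f
  | FEx f => exists d, sat M (env_cons d b) f
  end.

(* A first-order language is a set of formulae, possibly a proper fragment,
   with free variables among y_1, ..., y_r.  Negation is an operation of the
   language and need not be the syntactic [FNot]: over the integers, for
   instance, a language of linear constraints negates y1 <= y2 as y2 + 1 <= y1. *)
Record language L (D : Type) (M : structure L D) (r : nat) := Language {
  in_lang : formula L r -> Prop;
  cneg : formula L r -> formula L r;
  cneg_in : forall phi, in_lang phi -> in_lang (cneg phi);
  cnegP : forall phi (b : 'I_r -> D),
    in_lang phi -> (sat M b (cneg phi) <-> ~ sat M b phi)
}.

Record cform L D (M : structure L D) r (C : language M r) := CForm {
  cform_val :> formula L r;
  cform_in : in_lang C cform_val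
}.

Definition cform_neg L D (M : structure L D) r (C : language M r)
    (phi : cform C) : cform C :=
  CForm (cneg_in (cform_in phi)).

Definition satisfiable L D (M : structure L D) r (C : language M r)
    (S : cform C -> Prop) : Prop :=
  exists b : 'I_r -> D, forall phi, S phi -> sat M b phi.

Inductive bform (X : Type) : Type :=
| BTop
| BAtom of X
| BNot of bform X
| BAnd of bform X & bform X
| BOr of bform X & bform X.
Arguments BTop {X}.

Fixpoint beval X (v : X -> bool) (P : bform X) : bool :=
  match P with
  | BTop => true
  | BAtom x => v x
  | BNot P => ~~ beval v P
  | BAnd P Q => beval v P && beval v Q
  | BOr P Q => beval v P || beval v Q
  end.

Fixpoint bmap X Y (h : X -> Y) (P : bform X) : bform Y :=
  match P with
  | BTop => BTop
  | BAtom x => BAtom (h x)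
  | BNot P => BNot (bmap h P)
  | BAnd P Q => BAnd (bmap h P) (bmap h Q)
  | BOr P Q => BOr (bmap h P) (bmap h Q)
  end.

Fixpoint atoms X (P : bform X) : seq X :=
  match P with
  | BTop => [::]
  | BAtom x => [:: x]
  | BNot P => atoms P
  | BAnd P Q | BOr P Q => atoms P ++ atoms Q
  end.

Section Decomposition.

(* [k] non-interpreted and [r] interpreted positions. *)
Context (dom idom : eqType) (k r : nat).
Context (L : signature) (M : structure L idom) (C : language M r).

(* The atom (j, a) is the equality x_j = a. *)
Definition cond := bform ('I_k * dom).

Definition cond_holds (x : k.-tuple dom) (lambda : cond) : bool :=
  beval (fun e => tnth x e.1 == e.2) lambda.

Record cdc := Cdc { cdc_cond : cond; cdc_form : cform C }.

(* [view_form = None] encodes the absence of the conjunct sigma_i. *)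
Record view_def := ViewDef { view_cond : cond; view_form : option (cform C) }.

Notation tup := (k.-tuple dom * r.-tuple idom)%type.

(* A finite instance; the finite relations are given by enumerations of their
   tuples, of which only membership is ever used. *)
Record instance (m : nat) := Instance {
  inst_R : seq tup;
  inst_V : 'I_m -> seq tup
}.

Definition models_cdc m (I : instance m) (c : cdc) : Prop :=
  forall (x : k.-tuple dom) (y : r.-tuple idom),
    (x, y) \in inst_R I -> cond_holds x (cdc_cond c) ->
    sat M (tnth y) (cdc_form c).

Definition models_view m (I : instance m) (i : 'I_m) (v : view_def) : Prop :=
  forall (x : k.-tuple dom) (y : r.-tuple idom),
    (x, y) \in inst_V I i <->
    [/\ (x, y) \in inst_R I, cond_holds x (view_cond v)
      & if view_form v is Some sigma then sat M (tnth y) sigma else True].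

Context (d m : nat) (Delta : 'I_d -> cdc) (Sigma : 'I_m -> view_def).

Definition lossless : Prop :=
  forall I : instance m,
    (forall i, models_cdc I (Delta i)) ->
    (forall i, models_view I i (Sigma i)) ->
    forall (x : k.-tuple dom) (y : r.-tuple idom),
      (x, y) \in inst_R I <-> exists i, (x, y) \in inst_V I i.

(* The variables p_j^a, and the fresh variables v (one for each CDC) and v'
   (one for each view definition). *)
Definition pvar : eqType := (('I_k * dom) + ('I_d + 'I_m))%type.
Definition p_var (j : 'I_k) (a : dom) : pvar := inl (j, a).
Definition v_cdc (i : 'I_d) : pvar := inr (inl i).
Definition v_view (i : 'I_m) : pvar := inr (inr i).

Definition idf (v : pvar) : option (cform C) :=
  match v with
  | inl _ => None
  | inr (inl i) => Some (cdc_form (Delta i))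
  | inr (inr i) => view_form (Sigma i)
  end.

(* P -> v, with [None] standing for bottom on the right-hand side. *)
Record rule := Rule { ante : bform pvar; conseq : option pvar }.

Definition rule_true (v : pvar -> bool) (f : rule) : bool :=
  beval v (ante f) ==> (if conseq f is Some w then v w else false).

Definition prop_of (lambda : cond) : bform pvar :=
  bmap (fun e => p_var e.1 e.2) lambda.

Definition Pi_Delta (i : 'I_d) : rule :=
  Rule (prop_of (cdc_cond (Delta i))) (Some (v_cdc i)).

Definition Pi_Sigma (i : 'I_m) : rule :=
  Rule (prop_of (view_cond (Sigma i)))
       (if view_form (Sigma i) is Some _ then Some (v_view i) else None).

Definition var_p : seq pvar :=
  flatten [seq atoms (ante (Pi_Delta i)) | i <- enum 'I_d] ++
  flatten [seq atoms (ante (Pi_Sigma i)) | i <- enum 'I_m].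

Inductive Pi_aux : rule -> Prop :=
| Aux_bot i : conseq (Pi_Sigma i) = None -> Pi_aux (Pi_Sigma i)
| Aux_unique j a b :
    p_var j a \in var_p -> p_var j b \in var_p -> a <> b ->
    Pi_aux (Rule (BAnd (BAtom (p_var j a)) (BAtom (p_var j b))) None).

Definition valuation := seq_sub var_p -> bool.

(* Extension of a valuation of [var_p] by false; the value outside [var_p] is
   irrelevant for antecedents of the theories and for [Pi_aux]. *)
Definition extend (alpha : valuation) (v : pvar) : bool :=
  if insub v is Some u then alpha u else false.

Definition satisfies (alpha : valuation) (T : rule -> Prop) : Prop :=
  forall f, T f -> rule_true (extend alpha) f.

Definition filter_Delta (alpha : valuation) (phi : cform C) : Prop :=
  exists i v, [/\ conseq (Pi_Delta i) = Some v,
    beval (extend alpha) (ante (Pi_Delta i)) & idf v = Some phi].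

Definition filter_Sigma (alpha : valuation) (phi : cform C) : Prop :=
  exists i v psi, [/\ conseq (Pi_Sigma i) = Some v,
    beval (extend alpha) (ante (Pi_Sigma i)), idf v = Some psi
    & phi = cform_neg psi].

Definition filtering (alpha : valuation) (phi : cform C) : Prop :=
  filter_Delta alpha phi \/ filter_Sigma alpha phi.

(* Every position admits a value that no condition compares it with.
   Otherwise the valuation making all the p_j^a false for that j could satisfy
   [Pi_aux] and yet be realized by no tuple. *)
Definition unexhausted : Prop :=
  forall j : 'I_k, exists a : dom, p_var j a \notin var_p.

Lemma infinite_unexhausted :
  (forall s : seq dom, exists a, a \notin s) -> unexhausted.
Proof.
move=> dom_inf j.
pose s := pmap (fun v : pvar => if v is inl e then Some e.2 else None) var_p.
have [a aNs] := dom_inf s; exists a; apply: contra aNs => ja.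
by rewrite mem_pmap; apply/mapP; exists (p_var j a).
Qed.

End Decomposition.

(* Main.v *)
(** A single tuple [(x, y)] decides everything.  The truth values of the
    equalities [x_j = a] form a valuation satisfying the unique value axioms;
    conversely such a valuation is realized by some [x]: take at position [j]
    the value [a] whose variable [p_j^a] is true if there is one, and a value
    not mentioned in the conditions otherwise.  Under this correspondence
    [(x, y)] satisfies the CDCs and belongs to no view exactly when the
    valuation satisfies the auxiliary theory and [y] satisfies its filtering. *)

Require Import Defs.
From mathcomp Require Import all_boot.
From Stdlib Require Import FunctionalExtensionality.

Set Implicit Arguments.
Unset Strict Implicit.
Unset Printing Implicit Defensive.

Lemma beval_bmap X Y (h : X -> Y) v (P : bform X) :
  beval v (bmap h P) = beval (v \o h) P.
Proof. by elim: P => //= [P -> | P -> Q -> | P -> Q ->]. Qed.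

Lemma atoms_bmap X Y (h : X -> Y) (P : bform X) :
  atoms (bmap h P) = map h (atoms P).
Proof. by elim: P => //= P -> Q ->; rewrite map_cat. Qed.

Lemma eq_in_beval (X : eqType) (v w : X -> bool) (P : bform X) :
  {in atoms P, v =1 w} -> beval v P = beval w P.
Proof.
elim: P => //= [x | P IH | P IHP Q IHQ | P IHP Q IHQ] vw.
- by apply: vw; rewrite mem_head.
- by rewrite IH.
- by rewrite IHP ?IHQ // => x xP; apply: vw; rewrite mem_cat xP ?orbT.
- by rewrite IHP ?IHQ // => x xP; apply: vw; rewrite mem_cat xP ?orbT.
Qed.

Section Realization.

Context (dom idom : eqType) (k r : nat).
Context (L : signature) (M : structure L idom) (C : language M r).
Context (d m : nat) (Delta : 'I_d -> cdc dom k C).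
Context (Sigma : 'I_m -> view_def dom k C).

Local Notation p := (p_var (dom := dom) (k := k) d m).
Local Notation vars := (var_p Delta Sigma).

(** Agreement is demanded only on [vars]: elsewhere [extend alpha] is false, whatever [x] is. *)
Definition realizes (x : k.-tuple dom) (alpha : valuation Delta Sigma) : Prop :=
  forall j a, p j a \in vars -> extend alpha (p j a) = (tnth x j == a).

Lemma realizes_beval x alpha (lambda : cond dom k) :
  realizes x alpha -> {subset atoms (prop_of d m lambda) <= vars} ->
  beval (extend alpha) (prop_of d m lambda) = cond_holds x lambda.
Proof.
move=> xalpha sub; rewrite beval_bmap; apply: eq_in_beval => -[j a] ja /=.
by apply: xalpha; apply: sub; rewrite atoms_bmap; apply: (map_f _ ja).
Qed.

Lemma realizes_cdc x alpha i : realizes x alpha ->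
  beval (extend alpha) (ante (Pi_Delta m Delta i))
    = cond_holds x (cdc_cond (Delta i)).
Proof.
move=> xalpha; apply: realizes_beval => // v vi.
rewrite mem_cat; apply/orP; left; apply/flatten_mapP.
by exists i; rewrite ?mem_enum.
Qed.

Lemma realizes_view x alpha i : realizes x alpha ->
  beval (extend alpha) (ante (Pi_Sigma d Sigma i))
    = cond_holds x (view_cond (Sigma i)).
Proof.
move=> xalpha; apply: realizes_beval => // v vi.
rewrite mem_cat; apply/orP; right; apply/flatten_mapP.
by exists i; rewrite ?mem_enum.
Qed.

Lemma realizesW x : exists alpha, realizes x alpha.
Proof.
(* The default [false] is never consulted, since [realizes] only tests variables [p j a]. *)
exists (fun u => if val u is inl e then tnth x e.1 == e.2 else false) => j a ja.
by rewrite /extend insubT.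
Qed.

(** A tuple has a single value at each position, so the unique value axioms hold automatically; only
    the rules with right-hand side bottom remain. *)
Lemma realizes_satisfies x alpha : realizes x alpha ->
  satisfies alpha (Pi_aux Delta Sigma) <->
  forall i, view_form (Sigma i) = None -> ~~ cond_holds x (view_cond (Sigma i)).
Proof.
move=> xalpha; split=> [sat_aux i noform | noview _ [i noconseq | j a b ja jb ab]].
- have: conseq (Pi_Sigma d Sigma i) = None by rewrite /= noform.
  move=> noconseq; have := sat_aux _ (Aux_bot Delta noconseq).
  by rewrite /rule_true noconseq implybF (realizes_view _ xalpha).
- rewrite /rule_true noconseq implybF (realizes_view _ xalpha).
  by apply: noview; move: noconseq; rewrite /=; case: view_form.
- rewrite /rule_true /= implybF xalpha // xalpha //.
  by apply/negP=> /andP[/eqP xa /eqP xb]; apply: ab; rewrite -xa.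
Qed.

Lemma satisfies_realized alpha :
  unexhausted Delta Sigma -> satisfies alpha (Pi_aux Delta Sigma) ->
  exists x, realizes x alpha.
Proof.
move=> fresh sat_aux.
(* Each constraint involves one position only, so the entries of [x] can be chosen independently. *)
suff /fin_all_exists[x xP] (j : 'I_k) : exists c, forall a,
    p j a \in vars -> extend alpha (p j a) = (c == a).
  by exists (mktuple x) => j a /xP; rewrite tnth_mktuple.
pose true_at (v : pvar dom k d m) :=
  if v is inl e then (e.1 == j) && extend alpha v else false.
case: (boolP (has true_at vars)) => [/hasP[[[i c]|] //= jc] | /hasPn none].
  move=> /andP[/eqP/= ij alpha_c]; rewrite {i}ij in jc alpha_c.
  (* As [p j c] is true, the unique value axioms make every other [p j a] in [vars] false. *)
  exists c => a ja; have [<-|/eqP ca] := eqVneq c a; first exact: alpha_c.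
  have := sat_aux _ (Aux_unique jc ja ca).
  by rewrite /rule_true /= alpha_c /= implybF => /negbTE.
(* All variables at [j] are false, and the fresh [c] differs from every value they mention. *)
have [c jc] := fresh j; exists c => a ja.
have := none _ ja; rewrite /= eqxx /= => /negbTE ->.
by have [ca|//] := eqVneq; rewrite ca ja in jc.
Qed.

(** The rules fired by [alpha] are those whose conditions hold of [x], and [cnegP] reads the
    negation of the language as falsity. *)
Lemma realizes_filtering x alpha (b : 'I_r -> idom) : realizes x alpha ->
  (forall phi, filtering alpha phi -> sat M b phi) <->
  (forall i, cond_holds x (cdc_cond (Delta i)) -> sat M b (cdc_form (Delta i)))
  /\ (forall i sigma, view_form (Sigma i) = Some sigma ->
        cond_holds x (view_cond (Sigma i)) -> ~ sat M b sigma).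
Proof.
move=> xalpha; split=> [sat_filt | [satD satS] phi].
  split=> [i xi | i sigma form_i xi].
    apply: sat_filt; left; exists i, (v_cdc dom k m i).
    by split; rewrite // (realizes_cdc _ xalpha).
  apply/(cnegP b (cform_in sigma)); apply: (sat_filt (cform_neg sigma)).
  right; exists i, (v_view dom k d i), sigma.
  by split; rewrite ?(realizes_view _ xalpha) //= form_i.
case=> [[i [_ [[<-] + [<-]]]] | [i [v [sigma [+ + + ->]]]]].
  by rewrite (realizes_cdc _ xalpha); apply: satD.
rewrite (realizes_view _ xalpha) /=.
case form_i: (view_form (Sigma i)) => [tau|] // [<-] xi /= form_sigma.
by apply/(cnegP b (cform_in sigma)); apply: (satS i).
Qed.

End Realization.

Theorem theorem3 (dom idom : eqType) (n k : nat) (hkn : k <= n)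
    (L : signature) (M : structure L idom) (C : language M (n - k))
    (d m : nat)
    (Delta : 'I_d -> cdc dom k C) (Sigma : 'I_m -> view_def dom k C)
    (dom_unexhausted : unexhausted Delta Sigma) :
  lossless Delta Sigma <->
  forall alpha : valuation Delta Sigma,
    satisfies alpha (Pi_aux Delta Sigma) ->
    ~ satisfiable (filtering alpha).
Proof.
split=> [loss alpha sat_aux [b sat_filt] | unsat I Icdc Iview x y].
  have [x xalpha] := satisfies_realized dom_unexhausted sat_aux.
  have/(realizes_satisfies xalpha) noview := sat_aux.
  have/(realizes_filtering _ xalpha)[satD satS] := sat_filt.
  have tnth_b : tnth (mktuple b) = b.
    by apply: functional_extensionality => i; rewrite tnth_mktuple.
  (* Counterexample to losslessness: one tuple that every view misses, so that empty views obey
     [Sigma]. *)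
  pose I := Instance [:: (x, mktuple b)] (fun _ : 'I_m => [::]).
  have [||+ _] := loss I _ _ x (mktuple b).
  - move=> i _ _ /[1!inE] /eqP[-> ->]; rewrite tnth_b; exact: satD.
  - move=> i x' y'; split=> // -[] /[1!inE] /eqP[-> ->]; rewrite tnth_b.
    case form_i: (view_form (Sigma i)) => [sigma|] xi.
      by move/(satS _ _ form_i xi).
    by rewrite (negbTE (noview i form_i)) in xi.
  - by case/(_ (mem_head _ _)).
(* Membership and the range of [i] are decidable, which permits arguing by contradiction. *)
split=> [xyR | [i /Iview[]] //]; apply/existsP.
apply: contraT => /existsPn notV.
have [alpha xalpha] := realizesW Delta Sigma x.
case: (unsat alpha).
  (* A view without interpreted condition whose [view_cond] held of [x] would contain [(x, y)]. *)
  apply/(realizes_satisfies xalpha) => i form_i; apply: contra (notV i) => xi.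
  by apply/Iview; rewrite form_i.
exists (tnth y); apply/(realizes_filtering _ xalpha); split=> [i | i sigma].
  exact: Icdc.
by move=> form_i xi y_sigma; case/negP: (notV i); apply/Iview; rewrite form_i.
Qed.
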